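(* Let $K$ be a field, let $a,b>3$ be coprime integers and let $H_{a,b}=\langle a,b,ab-a-b\rangle$. Then $\mu(I_{H_{a,b}}^* )=4$.
   Context: $\langle a,b,ab-a-b\rangle$ is the subsemigroup of $\mathbb{N}$ (containing $0$) generated by the listed integers. $I_{H_{a,b}}\subset K[x,y,z]$ is the kernel of the $K$-algebra map $K[x,y,z]\to K[t]$ with $x\mapsto t^{a}$, $y\mapsto t^{b}$, $z\mapsto t^{ab-a-b}$. For a nonzero polynomial $f$, $f^*$ is its nonzero homogeneous component of least degree (standard grading), and $I_{H_{a,b}}^*=(f^*: f\in I_{H_{a,b}}, f\neq 0)$. For an ideal $J$, $\mu(J)$ is its minimal number of generators. *)

(* Defs.v *)
From HB Require Import structures.
From mathcomp Require Import all_boot all_order all_algebra.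
From mathcomp Require Export mpoly.

Set Implicit Arguments.
Unset Strict Implicit.
Unset Printing Implicit Defensive.

Import GRing.Theory.
Local Open Scope ring_scope.

(* Ideals are Prop-valued, since membership in an ideal generated by an
   arbitrary (possibly infinite) set is not decidable a priori. *)
Definition ideal_gen (R : comNzRingType) (S : R -> Prop) (p : R) : Prop :=
  exists s : seq (R * R),
    (forall u, u \in s -> S u.2) /\ p = \sum_(u <- s) u.1 * u.2.

Definition generates (R : comNzRingType) (s : seq R) (J : R -> Prop) : Prop :=
  forall p, J p <-> ideal_gen (fun g => g \in s) p.

(* mu(J) = k; in particular J is finitely generated. *)
Definition min_nb_generators (R : comNzRingType) (J : R -> Prop) (k : nat)
    : Prop :=
  (exists s : seq R, size s = k /\ generates s J) /\
  (forall s : seq R, generates s J -> (k <= size s)%N).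

Definition semigroup_map (K : fieldType) (n : nat) (g : n.-tuple nat)
    (f : {mpoly K[n]}) : {poly K} :=
  mmap (@polyC K) (fun i => 'X^(tnth g i)) f.

(* The defining ideal of the numerical semigroup <g_0, ..., g_(n-1)>, with
   respect to the listed generators. *)
Definition semigroup_ideal (K : fieldType) (n : nat) (g : n.-tuple nat)
    (f : {mpoly K[n]}) : Prop :=
  semigroup_map g f = 0.

(* The least degree of a monomial of f. The default value msize f exceeds the
   degree of every monomial, so it only matters for f = 0. *)
Definition mord (K : fieldType) (n : nat) (f : {mpoly K[n]}) : nat :=
  \big[minn/msize f]_(m <- msupp f) mdeg m.

(* The initial form f^*, meaningful for f != 0. *)
Definition initform (K : fieldType) (n : nat) (f : {mpoly K[n]})
    : {mpoly K[n]} :=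
  pihomog mdeg (mord f) f.

Definition initial_ideal (K : fieldType) (n : nat) (J : {mpoly K[n]} -> Prop)
    : {mpoly K[n]} -> Prop :=
  ideal_gen (fun g => exists f, [/\ J f, f != 0 & g = initform f]).

(* Main.v *)
(* Let a < b. The relations xz = y^(a-1), yz = x^(b-1), z^2 = x^(b-2) y^(a-2)
   and y^a = x^b hold between t^a, t^b and t^(ab-a-b), and each of them raises
   the degree. The monomials not divisible by xz, yz, z^2 or y^a are z and the
   x^i y^j with j < a; they have pairwise distinct weights because a and b are
   coprime and ab-a-b is not in <a, b>. So each of them has the largest degree
   among the monomials of its weight, and the initial ideal is
   (xz, yz, z^2, y^a). A monomial ideal with n minimal monomials needs n
   generators, since multiplication by h acts on the coefficients at the minimal
   monomials as the scalar h(0). *)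
Require Import Defs.
From mathcomp Require Import all_boot all_order all_algebra.
From mathcomp Require Import zify.

Set Implicit Arguments.
Unset Strict Implicit.
Unset Printing Implicit Defensive.

Import GRing.Theory.

(** * Monomial ideals *)

Section MonomialIdeals.

Local Open Scope ring_scope.

Lemma mem_ideal_gen (R : comNzRingType) (S : R -> Prop) (p : R) :
  S p -> ideal_gen S p.
Proof.
move=> Sp; exists [:: (1, p)]; rewrite big_seq1 mul1r; split=> // u.
by rewrite mem_seq1 => /eqP->.
Qed.

Lemma ideal_genD (R : comNzRingType) (S : R -> Prop) (p q : R) :
  ideal_gen S p -> ideal_gen S q -> ideal_gen S (p + q).
Proof.
move=> [s [sS ->]] [t [tS ->]]; exists (s ++ t); rewrite big_cat; split=> // u.
by rewrite mem_cat => /orP[/sS|/tS].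
Qed.

Lemma ideal_genM (R : comNzRingType) (S : R -> Prop) (h p : R) :
  ideal_gen S p -> ideal_gen S (h * p).
Proof.
move=> [s [sS ->]]; exists [seq (h * u.1, u.2) | u <- s]; split.
  by move=> _ /mapP[u us ->]; apply: (sS u us).
by rewrite big_map mulr_sumr; apply: eq_bigr => u _; rewrite mulrA.
Qed.

Lemma ideal_gen_sum (R : comNzRingType) (S : R -> Prop) (I : eqType)
    (r : seq I) (P : pred I) (F : I -> R) :
  (forall i, i \in r -> P i -> ideal_gen S (F i)) ->
  ideal_gen S (\sum_(i <- r | P i) F i).
Proof.
move=> SF; rewrite big_seq_cond; apply: (big_ind (ideal_gen S)).
- by exists [::]; split=> //; rewrite big_nil.
- exact: ideal_genD.
- by move=> i /andP[]; apply: SF.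
Qed.

Lemma ideal_gen_sub (R : comNzRingType) (S T : R -> Prop) (p : R) :
  (forall q, S q -> ideal_gen T q) -> ideal_gen S p -> ideal_gen T p.
Proof.
move=> ST [s [sS ->]]; apply: ideal_gen_sum => u us _.
by apply/ideal_genM/ST/sS.
Qed.

Variables (K : fieldType) (n : nat).
Implicit Types (m : 'X_{1..n}) (ms : seq 'X_{1..n}) (p q : {mpoly K[n]}).

Definition monomials ms : seq {mpoly K[n]} := [seq 'X_[m] | m <- ms].

(** Every monomial of a multiple of ['X_[m']] is divisible by [m']; conversely, a polynomial is the
    sum of its terms, each here a multiple of a listed monomial. *)
Lemma monomial_idealP ms p :
  ideal_gen (fun q => q \in monomials ms) p <->
  (forall m, m \in msupp p -> has (fun m' => (m' <= m)%MM) ms).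
Proof.
split=> [[s [s_ms ->]] m|ms_p].
  rewrite mcoeff_msupp raddf_sum /=; apply: contraR => /hasPn ms_m.
  apply/eqP; rewrite big_seq big1 // => u us.
  have /mapP[m' m'ms ->] := s_ms u us.
  apply/eqP; rewrite -[_ == 0]negbK -mcoeff_msupp (perm_mem (msuppMX _ _)).
  apply: contra (ms_m m' m'ms) => /mapP[m'' _ ->].
  exact: lem_addr.
rewrite [p]mpolyE; apply: ideal_gen_sum => m /ms_p/hasP[m' m'ms le_m'm] _.
rewrite -mul_mpolyC -(submK le_m'm) mpolyXD mulrA.
by apply/ideal_genM/mem_ideal_gen/map_f.
Qed.

Definition antichain ms : bool :=
  all (fun m => all (fun m' => (m' <= m)%MM ==> (m' == m)) ms) ms.

(* Since [m] is a minimal monomial of the ideal, [h - h(0)] contributes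
   nothing to its coefficient. *)
Lemma mcoeff_mul_monomial_ideal ms h p m :
  antichain ms -> m \in ms ->
  ideal_gen (fun q => q \in monomials ms) p ->
  (h * p)@_m = h@_0%MM * p@_m.
Proof.
move=> /allP ams m_ms /monomial_idealP ms_p.
rewrite -[h in LHS](subrK (h@_0%MM)%:MP) mulrDl mcoeffD mul_mpolyC mcoeffZ.
rewrite -[RHS]add0r; congr (_ + _).
rewrite mcoeffM big1 // => -[[k1 /= _] [k2 /= _]] /eqP m_k.
have [/eqP->|k2p] := boolP (p@_k2 == 0); first by rewrite mulr0.
rewrite -mcoeff_msupp in k2p; have /hasP[m' m'ms le_m'k2] := ms_p _ k2p.
have le_k2m : (k2 <= m)%MM by rewrite m_k lem_addl.
have /eqP m'm : m' == m.
  have /allP/(_ m' m'ms)/implyP := ams m m_ms; apply.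
  exact: lepm_trans le_k2m.
have k1_0 : k1 = 0%MM.
  apply/mnmP=> i; rewrite mnm0E.
  have /mnm_lepP/(_ i) := le_m'k2.
  by move: m_k => /mnmP/(_ i); rewrite m'm mnmDE; lia.
by rewrite k1_0 mcoeffB mcoeffC eqxx mulr1 subrr mul0r.
Qed.

(** Let [L] read off the coefficients at the monomials of [ms]. On [J], multiplication by [h]
    becomes scaling by h(0), so the images under [L] of any generators of [J] span all unit vectors;
    a rank count bounds their number from below. *)
Lemma min_nb_generators_monomial (J : {mpoly K[n]} -> Prop) ms :
  uniq ms -> antichain ms -> generates (monomials ms) J ->
  min_nb_generators J (size ms).
Proof.
move=> uniq_ms anti_ms ms_J; split.
  by exists (monomials ms); rewrite size_map.
move=> s s_J; pose e (i : 'I_(size ms)) := nth 0%MM ms i.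
have e_ms i : e i \in ms by apply: mem_nth.
pose L (p : {mpoly K[n]}) : 'rV[K]_(size ms) := \row_i p@_(e i).
pose B : 'M[K]_(size s, size ms) := \matrix_(k < size s) L (nth 0 s k).
suff sub1B : (1%:M <= B)%MS.
  by rewrite -(mxrank1 K (size ms)) (leq_trans (mxrankS sub1B)) ?rank_leq_row.
apply/row_subP => i.
have [t [t_s eq_t]] : ideal_gen (fun g => g \in s) 'X_[e i].
  by apply/s_J/ms_J/mem_ideal_gen/map_f.
have -> : row i 1%:M = \sum_(u <- t) u.1@_0%MM *: L u.2.
  apply/rowP=> j; rewrite summxE !mxE.
  have <- : ('X_[e i])@_(e j) = (i == j)%:R :> K.
    by rewrite mcoeffX nth_uniq.
  rewrite eq_t raddf_sum /= !big_seq; apply: eq_bigr => u /t_s us.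
  rewrite !mxE; apply: mcoeff_mul_monomial_ideal anti_ms (e_ms j) _.
  by apply/ms_J/s_J/mem_ideal_gen.
rewrite big_seq; apply: summx_sub => u /t_s us; apply: scalemx_sub.
have lt_us : (index u.2 s < size s)%N by rewrite index_mem.
have -> : L u.2 = row (Ordinal lt_us) B by rewrite rowK /= nth_index.
exact: row_sub.
Qed.

End MonomialIdeals.

(** * Initial ideals of semigroup ideals *)

Section InitialIdeals.

Local Open Scope ring_scope.

Variables (K : fieldType) (n : nat).
Implicit Types (m : 'X_{1..n}) (p f : {mpoly K[n]}).

Lemma mord_le f m : m \in msupp f -> (mord f <= mdeg m)%N.
Proof.
rewrite /mord; elim: (msupp f) => //= m' s IHs.
rewrite in_cons big_cons => /orP[/eqP<-|/IHs]; first exact: geq_minl.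
exact/leq_trans/geq_minr.
Qed.

Lemma mordP f : f != 0 -> exists2 m, m \in msupp f & mord f = mdeg m.
Proof.
rewrite -msupp_eq0 /mord => f0.
(* The default [msize f] is at least every degree, so the minimum over a nonempty support is
   attained at a monomial. *)
have: all (fun m => (mdeg m <= msize f)%N) (msupp f).
  by apply/allP => m /msize_mdeg_lt/ltnW.
elim: (msupp f) f0 => //= m [|m' s] IHs _ /andP[le_m le_s].
  by exists m; rewrite ?mem_head // big_cons big_nil; apply/minn_idPl.
have [m1 m1s E] := IHs isT le_s; rewrite big_cons E.
have [_|_] := leqP (mdeg m) (mdeg m1); first by exists m; rewrite ?mem_head.
by exists m1; rewrite // in_cons m1s orbT.
Qed.

Lemma msupp_initform f m :
  (m \in msupp (initform f)) = (m \in msupp f) && (mdeg m == mord f).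
Proof.
rewrite !mcoeff_msupp /initform pihomogE raddf_sum /= big_mkcond /=.
have [mf|mf] := boolP (m \in msupp f).
  rewrite (bigD1_seq m) //= big1 => [|m' /negPf m'm].
    case: ifP; rewrite ?addr0 ?eqxx ?andbF //.
    by rewrite mcoeffZ mcoeffX eqxx mulr1 andbT.
  by case: ifP => // _; rewrite mcoeffZ mcoeffX m'm mulr0.
rewrite -mcoeff_msupp (negPf mf) big_seq big1 ?eqxx // => m' m'f.
case: ifP => // _; rewrite mcoeffZ mcoeffX.
by case: eqP mf => [<-|]; rewrite ?m'f // mulr0.
Qed.

Lemma initform_binomial m m' : (mdeg m < mdeg m')%N ->
  'X_[K, m] - 'X_[K, m'] != 0 /\ initform ('X_[K, m] - 'X_[K, m']) = 'X_[m].
Proof.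
move=> lt_mm'; set f := _ - _.
have nm : (m' == m) = false by apply: contraTF lt_mm' => /eqP->; rewrite ltnn.
have mf : m \in msupp f.
  by rewrite mcoeff_msupp mcoeffB !mcoeffX eqxx nm subr0 oner_neq0.
have f0 : f != 0 by apply: contraTneq mf => ->; rewrite msupp0.
have ord_f : mord f = mdeg m.
  apply/eqP; rewrite eqn_leq mord_le //=.
  have [m1 + ->] := mordP f0; rewrite mcoeff_msupp mcoeffB !mcoeffX.
  have [<-|_] := eqVneq m m1; first by [].
  by have [<- _|_] := eqVneq m' m1; rewrite ?(ltnW lt_mm') // subrr eqxx.
split=> //; rewrite /initform ord_f pihomogB !pihomogX eqxx.
by rewrite gtn_eqF // subr0.
Qed.

Definition weight (g : n.-tuple nat) m : nat := (\sum_i m i * tnth g i)%N.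

Lemma semigroup_mapE g f :
  semigroup_map g f = \sum_(m <- msupp f) f@_m *: 'X^(weight g m).
Proof.
apply: eq_bigr => m _; rewrite -mul_polyC; congr (_ * _).
rewrite /mmap1 /weight -prodrXr; apply: eq_bigr => i _.
by rewrite -exprM mulnC.
Qed.

Lemma semigroup_mapX g m : semigroup_map g 'X_[K, m] = 'X^(weight g m).
Proof. by rewrite semigroup_mapE msuppX big_seq1 mcoeffX eqxx scale1r. Qed.

(* Each fibre of the weight on the support of an element of the semigroup ideal
   has coefficient sum 0, so it cannot be a singleton; hence a monomial of
   maximal degree in its weight class never survives in an initial form. *)
Lemma generates_initial_ideal g (ms : seq 'X_{1..n}) :
  (forall m, m \in ms ->
     exists2 m', weight g m' = weight g m & (mdeg m < mdeg m')%N) ->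
  (forall m m', ~~ has (fun m1 => (m1 <= m)%MM) ms ->
     weight g m' = weight g m -> m' != m -> (mdeg m' < mdeg m)%N) ->
  generates (monomials K ms) (initial_ideal (semigroup_ideal (K := K) g)).
Proof.
move=> ms_red ms_max p; split; apply: ideal_gen_sub => q; last first.
  move=> /mapP[m /ms_red[m' wm' lt_mm'] ->]; apply: mem_ideal_gen.
  have [f0 fE] := initform_binomial lt_mm'.
  exists ('X_[m] - 'X_[m']); split=> //.
  by rewrite /semigroup_ideal /semigroup_map mmapB -!/(semigroup_map _ _)
             !semigroup_mapX wm' subrr.
move=> [f [+ _ ->]]; rewrite /semigroup_ideal semigroup_mapE => If.
apply/monomial_idealP => m; rewrite msupp_initform => /andP[mf /eqP deg_m].
apply: contraT => /ms_max m_max.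
have /eqP := congr1 (fun r : {poly K} => r`_(weight g m)) If.
rewrite coef0 coef_sum (bigD1_seq m) //= coefZ coefXn eqxx mulr1.
rewrite big_seq_cond big1 ?addr0 => [|m' /andP[m'f m'm]].
  by rewrite -[_ == 0]negbK -mcoeff_msupp mf.
rewrite coefZ coefXn; have [wm|] := eqVneq; last by rewrite mulr0.
have := m_max m' (esym wm) m'm.
by rewrite deg_m ltnNge mord_le.
Qed.

End InitialIdeals.

(** * The semigroup generated by a, b and ab - a - b *)

Section Frobenius.

Variables a b : nat.
Hypotheses (ha : 3 < a) (hab : a < b) (cop : coprime a b).

(** Truncated subtraction loses nothing here, since [a + b < 2 * b <= a * b]. *)
Lemma frobenius_lin : a * b - a - b + a + b = a * b.
Proof.
have : 2 * b <= a * b by rewrite leq_mul2r; lia.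
by lia.
Qed.

(** Otherwise adding [a + b] gives [a * p.+1 + b * q.+1 = a * b]. By coprimality [a] divides [q.+1],
    so the second term alone is at least [a * b], while the first is positive. *)
Lemma frobenius_not_mem p q : a * p + b * q <> a * b - a - b.
Proof.
move=> eq_pq; have E : a * p.+1 + b * q.+1 = a * b.
  by have := frobenius_lin; lia.
have /dvdnP[k kE] : a %| q.+1.
  rewrite -(Gauss_dvdr _ cop) -(dvdn_addr (m := a * p.+1)) ?dvdn_mulr //.
  by rewrite E dvdn_mulr.
move: E; rewrite kE; case: k kE => // k _.
have : 0 < a * p.+1 by rewrite muln_gt0; lia.
by lia.
Qed.

(** By coprimality [a] divides the difference of [q] and [q'], which is smaller than [a], hence
    zero. *)
Lemma weight_inj p q p' q' : q < a -> q' < a ->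
  a * p + b * q = a * p' + b * q' -> p = p' /\ q = q'.
Proof.
wlog le_qq' : p q p' q' / q <= q' => [W lt_q lt_q' E|_ lt_q' E].
  have [/W|/ltnW/W] := leqP q q'; first exact.
  by case/(_ _ _ lt_q' lt_q (esym E)) => -> ->.
have : a %| b * (q' - q).
  apply/dvdnP; exists (p - p').
  by rewrite mulnBr mulnBl; lia.
rewrite Gauss_dvdr // => a_dvd.
have qq' : q = q'.
  by have := dvdn_leq _ a_dvd; lia.
split=> //; apply/eqP; rewrite -(eqn_pmul2l (m := a)); last by lia.
by move: E; rewrite qq' => /addIn->.
Qed.

(** The quotient of [q] by [a] counts the replacements of y^a by x^b; each raises the degree because
    [a < b]. *)
Lemma weight_normalize p q : exists p' q',
  [/\ q' < a, a * p' + b * q' = a * p + b * q &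
      (p', q') = (p, q) \/ p + q < p' + q'].
Proof.
have a0 : 0 < a by lia.
exists (p + b * (q %/ a)), (q %% a).
have := divn_eq q a; have := ltn_pmod q a0.
move: (q %/ a) (q %% a) => k r lt_r ->.
split; [by []|lia|].
case: k => [|k]; [by left; rewrite muln0 !addn0|right].
have : k.+1 * a < k.+1 * b by rewrite ltn_mul2l.
by lia.
Qed.

(* Rewriting with z^2 -> x^(b-2) y^(a-2), xz -> y^(a-1), yz -> x^(b-1)
   preserves the weight and raises the degree. *)
Lemma weight_eliminate p q r :
  0 < r -> (p, q, r) != (0, 0, 1) -> exists p' q',
  a * p' + b * q' = a * p + b * q + (a * b - a - b) * r /\
  p + q + r < p' + q'.
Proof.
move: frobenius_lin; move: (a * b - a - b) => c.
(* With [a = a' + 4] and [b = b' + 4], the exponents a-1, a-2, b-1, b-2 become sums, free of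
   truncated subtraction. *)
have [a' aE] : exists a', a = a' + 4 by exists (a - 4); lia.
have [b' bE] : exists b', b = b' + 4 by exists (b - 4); lia.
rewrite aE bE => cE {aE bE}.
elim/ltn_ind: r p q => -[|[|[|r]]] // IHr p q _ nz.
- case: p q nz => [|p] [|q] nz //.
  + by exists (b' + 3), q; lia.
  + by exists p, (a' + 3); lia.
  + by exists p, (q + a' + 4); lia.
- by exists (p + b' + 2), (q + a' + 2); lia.
- have nz' : (p + b' + 2, q + a' + 2, r.+1) != (0, 0, 1).
    by rewrite !xpair_eqE; lia.
  have [p' [q' [E lt]]] := IHr r.+1 (ltnW (ltnSn _)) _ _ isT nz'.
  by exists p', q'; split; [rewrite E|]; lia.
Qed.

(** Unless it is z, the monomial [(p, q, r)] rewrites to some x^p' y^q' with [q' < a], of the same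
    weight and of larger degree if anything changed. A normal monomial of that weight can only be
    this endpoint: z is ruled out by [frobenius_not_mem], the others by [weight_inj]. *)
Lemma weight_normal_max i j k p q r :
  (k == 0) && (j < a) || ((i, j, k) == (0, 0, 1)) ->
  a * p + b * q + (a * b - a - b) * r = a * i + b * j + (a * b - a - b) * k ->
  (p, q, r) != (i, j, k) -> p + q + r < i + j + k.
Proof.
have [[-> -> ->]|nz] := eqVneq (p, q, r) (0, 0, 1).
  case/orP=> [/andP[/eqP-> _]|/eqP[-> -> ->]]; last by rewrite eqxx.
  by rewrite !muln0 muln1 !addn0 add0n => /esym/frobenius_not_mem.
have [p' [q' [lt_q' <- lt]]] : exists p' q',
    [/\ q' < a, a * p' + b * q' = a * p + b * q + (a * b - a - b) * r &
        (p', q', 0) = (p, q, r) \/ p + q + r < p' + q'].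
  case: r nz => [|r] nz.
    have [p' [q' [lt_q' E lt]]] := weight_normalize p q.
    exists p', q'; rewrite muln0 !addn0; split=> //.
    by case: lt => [[-> ->]|]; [left|right].
  have [p1 [q1 [E1 lt1]]] := weight_eliminate (ltn0Sn r) nz.
  have [p' [q' [lt_q' E lt]]] := weight_normalize p1 q1.
  exists p', q'; split; rewrite ?E //; right.
  by case: lt => [[-> ->] //|]; apply: ltn_trans.
case/orP=> [/andP[/eqP-> lt_ja]|/eqP[-> -> ->]]; last first.
  by rewrite !muln0 muln1 add0n => /frobenius_not_mem.
rewrite muln0 !addn0 => /(weight_inj lt_q' lt_ja)[p'i q'j]; subst p' q'.
by case: lt => [->|//]; rewrite eqxx.
Qed.

End Frobenius.

(** * The initial ideal in three variables *)

Section FrobeniusIdeal.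

Variables (K : fieldType) (a b : nat) (g : 3.-tuple nat) (x y z : 'I_3).
Hypotheses (ha : 3 < a) (hab : a < b) (cop : coprime a b).
Hypotheses (gx : tnth g x = a) (gy : tnth g y = b).
Hypotheses (gz : tnth g z = a * b - a - b) (uniq_xyz : uniq [:: x; y; z]).

Let mem_xyz : [:: x; y; z] =i 'I_3.
Proof.
have [||_ E] := uniq_min_size (s2 := enum 'I_3) uniq_xyz.
- by move=> t _; rewrite mem_enum.
- by rewrite size_enum_ord.
- by move=> t; rewrite E mem_enum.
Qed.

Let sum_xyz (F : 'I_3 -> nat) : \sum_t F t = F x + F y + F z.
Proof.
rewrite (perm_big [:: x; y; z]) => [|/=].
  by rewrite !big_cons big_nil /= addn0 addnA.
apply: uniq_perm => [||t] //; first exact: index_enum_uniq.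
by rewrite mem_index_enum mem_xyz.
Qed.

(** The positions of the variables stay abstract, so that x and y can be exchanged to order [a] and
    [b]. *)
Let mon i j k : 'X_{1..3} := (U_(x) *+ i + U_(y) *+ j + U_(z) *+ k)%MM.

Let monE i j k : (mon i j k x = i) * (mon i j k y = j) * (mon i j k z = k).
Proof.
move: uniq_xyz; rewrite /= !inE negb_or andbT => /andP[/andP[xy xz] yz].
rewrite !mnmDE !mulmnE !mnm1E !eqxx (eq_sym y x) (eq_sym z x) (eq_sym z y).
by rewrite (negPf xy) (negPf xz) (negPf yz) !mul0n !mul1n !addn0 !add0n.
Qed.

Let forall_xyz (P : 'I_3 -> Prop) : P x -> P y -> P z -> forall t, P t.
Proof.
move=> Px Py Pz t; have : t \in [:: x; y; z] by rewrite mem_xyz.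
by rewrite !inE => /or3P[] /eqP->.
Qed.

Let mon_le i j k (m : 'X_{1..3}) :
  (mon i j k <= m)%MM = [&& i <= m x, j <= m y & k <= m z].
Proof.
apply/mnm_lepP/and3P=> [le_m|[le_x le_y le_z]].
  by have := (le_m x, le_m y, le_m z); rewrite !monE => -[[]].
by apply: forall_xyz; rewrite monE.
Qed.

Let monK (m : 'X_{1..3}) : mon (m x) (m y) (m z) = m.
Proof. by apply/mnmP; apply: forall_xyz; rewrite monE. Qed.

Let mon_eq i j k i' j' k' :
  (mon i j k == mon i' j' k') = [&& i == i', j == j' & k == k'].
Proof.
apply/eqP/and3P=> [E|[/eqP-> /eqP-> /eqP->] //].
by have := (monE i j k); rewrite E !monE => -[[-> ->] ->].
Qed.

Let mon_mdeg m : mdeg m = m x + m y + m z.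
Proof. by rewrite mdegE sum_xyz. Qed.

Let mon_weight m : weight g m = a * m x + b * m y + (a * b - a - b) * m z.
Proof. by rewrite /weight sum_xyz gx gy gz ![_ * m _]mulnC. Qed.

Lemma min_nb_generators_initial_ideal :
  min_nb_generators (initial_ideal (semigroup_ideal (K := K) g)) 4.
Proof.
pose ms := [:: mon 1 0 1; mon 0 1 1; mon 0 0 2; mon 0 a 0].
apply: (@min_nb_generators_monomial _ _ _ ms).
- by rewrite /ms /= !inE !mon_eq; lia.
- by rewrite /ms /antichain /= !mon_le !monE !mon_eq; lia.
apply: generates_initial_ideal => [m m_ms|m m' ms_m wm' m'm].
  have {}m_ms : mon (m x) (m y) (m z) \in ms by rewrite monK.
  have [p [q [E lt]]] : exists p q,
      a * p + b * q = a * m x + b * m y + (a * b - a - b) * m z /\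
      m x + m y + m z < p + q.
    have [mz|mz] := posnP (m z); last first.
      apply: (weight_eliminate ha hab) => //.
      by move: m_ms; rewrite /ms !inE !mon_eq !xpair_eqE; lia.
    (* Without z the monomial is y^a, which x^b replaces. *)
    exists b, 0; move: m_ms; rewrite /ms !inE !mon_eq mz !andbF !andbT /=.
    by move=> /andP[/eqP-> /eqP->]; lia.
  by exists (mon p q 0); rewrite ?mon_weight ?mon_mdeg !monE ?muln0 ?addn0.
rewrite !mon_mdeg; apply: (weight_normal_max ha hab cop).
(* Avoiding xz, yz, z^2 and y^a leaves z itself or x^i y^j with [j < a]. *)
- by move: ms_m; rewrite /ms /= !mon_le !xpair_eqE; lia.
- by rewrite -!mon_weight.
- by rewrite -(monK m) -(monK m') mon_eq in m'm; rewrite !xpair_eqE; lia.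
Qed.

End FrobeniusIdeal.

Theorem mainTheorem9 (K : fieldType) (a b : nat)
    (ha : 3 < a) (hb : 3 < b) (hab : coprime a b) :
  min_nb_generators
    (initial_ideal (semigroup_ideal (K := K) [tuple a; b; a * b - a - b])) 4.
Proof.
pose i0 : 'I_3 := @Ordinal 3 0 isT.
pose i1 : 'I_3 := @Ordinal 3 1 isT.
pose i2 : 'I_3 := @Ordinal 3 2 isT.
(* For [b < a] the first two variables swap roles; [a = b] would force [a = 1] by coprimality. *)
have [lt_ab|lt_ba|eq_ab] := ltngtP a b.
- exact: (@min_nb_generators_initial_ideal K a b _ i0 i1 i2).
- apply: (@min_nb_generators_initial_ideal K b a _ i1 i0 i2) => //.
    by rewrite coprime_sym.
  by rewrite [b * a]mulnC subnAC.
- by move: hab ha; rewrite eq_ab /coprime gcdnn => /eqP->.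
Qed.
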